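(* Let $n\ge 2$ operators share the spectrum, and let $T$ be a positive integer. Suppose that $$r(P)>\sup_{m\ge 2}\Big[m\, r\Big(\tfrac{P}{(m-1)P+1}\Big)\Big]$$ and that for every operator $i\in\{1,\dots,n\}$ and every traffic intensity $\lambda$, $$\overline U^i(\lambda)-\pi^i(w,\lambda)<T\,(u_o^i-u_f^i).$$ Then there is $\delta_0\in[0,1)$ such that for every discount factor $\delta\in(\delta_0,1)$ the strategy profile ''equal orthogonal sharing with $T$-slot punishment'' (described in the context) is a subgame perfect Nash equilibrium of the infinitely repeated spectrum sharing game with $n$ operators.
   Context: Model. $\mathcal S\subset\mathbb R$ is a finite union of bounded intervals of total length $W>0$ (the spectrum); $P>0$ is the peak power spectral density (PSD). A feasible PSD is a measurable function $p:\mathcal S\to[0,P]$ (identified up to a.e. equality); $\mathcal P$ is the set of feasible PSDs. Time is slotted, $t=0,1,2,\dots$. In slot $t$ operator $i$ uses PSD $p^i_t\in\mathcal P$ and has SINR $\gamma^i_t(f)=\dfrac{p^i_t(f)}{1+\sum_{j\ne i}p^j_t(f)}$. The function $r:[0,\infty)\to[0,\infty)$ is strictly increasing. The one-slot utility of operator $i$ with traffic intensity $\lambda^i_t$ is $$u^i(p^i_t,p^{-i}_t,\lambda^i_t)=\pi^i\Big(\frac1{r(P)}\int_{\mathcal S}r(\gamma^i_t(f))\,df,\ \lambda^i_t\Big),$$ which is bounded and nonnegative, where $p^{-i}_t$ denotes the PSDs of all operators other than $i$. Each $\pi^i(x,\lambda)$ is (a) continuous, strictly increasing and strictly concave in $x$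 for every $\lambda$; (b) finite and strictly supermodular: $\pi^i(x+\Delta,\lambda)-\pi^i(x,\lambda)<\pi^i(x+\Delta,\xi)-\pi^i(x,\xi)$ for all $x$, $\xi>\lambda$, $\Delta>0$. The traffic intensities $\{\Lambda^i_t\}_{t\ge0}$ are exogenous random processes, independent across operators, with the law of $\Lambda^i_t$ not depending on $t$. Repeated game (static sharing, perfect monitoring). At the end of each slot all operators observe all PSDs used. A strategy maps each finite history of PSD tuples to a PSD for the current slot (it does not depend on traffic intensities). The payoff of operator $i$ is the expectation of the total revenue $V^i=(1-\delta)\sum_{t\ge0}\delta^t u^i(p^i_t,p^{-i}_t,\Lambda^i_t)$, $\delta\in[0,1)$. A profile is a subgame perfect Nash equilibrium if after every finite history its restriction to the continuation game is a Nash equilibrium. Notation. $w=W/n$. The full-spectrum strategy is the PSD $p\equiv P$ on $\mathcal S$. $\pi^i_f(\lambda)=\pi^i\big(\frac{W}{r(P)}r\big(\frac{P}{P(n-1)+1}\big),\lambda\big)$ and $u^i_f=\mathsf E[\pi^i_f(\Lambda^i_t)]$. Fix a partition of $\mathcal S$ into measurable sets $\mathcal S_1,\dots,\mathcal S_n$ of length $W/n$ each, and let $p^i_o=P\cdot 1_{\mathcal S_i}$ (equal, orthogonal sharing); $u^i_o=\mathsf E[u^i(p^i_o,p^{-i}_o,\Lambda^i_t)]=\mathsf E[\pi^i(W/n,\Lambda^i_t)]$. $\overline U^i(\lambda)=\sup_{p,p^{-i}}u^i(p,p^{-i},\lambda)$. The profile (equal orthogonal sharing with $T$-slot punishment). Every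 operator $i$ uses $p^i=p^i_o$ in slot $0$. In each later slot: (I) Cooperation state: if the PSDs in the previous slot were $(p^1,\dots,p^n)$, use $p^i$; otherwise move to the punishment state. (II) Punishment state: if any operator was detected to deviate from this profile, in any state, in the previous slot, then use maximum power $P$ over the entire spectrum for $T$ slots (so a deviation during punishment restarts the $T$ slots), and then resume using $p^i$ and return to the cooperation state. *)

(* Defs.v *)
From HB Require Import structures.
From mathcomp Require Import all_boot all_order all_algebra.
From mathcomp Require Import all_classical all_reals all_analysis.
From mathcomp Require Import measurable_realfun.
Import Order.TTheory GRing.Theory Num.Theory.
Import numFieldNormedType.Exports.

Set Implicit Arguments.
Unset Strict Implicit.
Unset Printing Implicit Defensive.

Local Open Scope classical_set_scope.
Local Open Scope ring_scope.
Local Open Scope quotient_scope.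

Section psd.
Context {R : realType}.
Notation mu := (@lebesgue_measure R).

Definition is_spectrum (S : set R) :=
  exists s : seq (interval R),
    (forall J, J \in s -> bounded_set [set` J]) /\
    S = \big[setU/set0]_(J <- s) [set` J].

Definition bandwidth (S : set R) : R := fine (mu S).

Variables (S : set R) (P : R).

(* The values taken outside S are irrelevant: they are ignored by [psd_equiv]. *)
Definition feasible : set (R -> R) :=
  [set p : R -> R | measurable_fun S p /\ forall f, S f -> 0 <= p f <= P].

Definition psd_equiv (p q : set_type feasible) : bool :=
  `[< ae_eq mu S (val p) (val q) >].

Lemma psd_equiv_refl : reflexive psd_equiv.
Proof. by move=> p; apply/asboolP; exact: ae_eq_refl. Qed.

Lemma psd_equiv_sym : symmetric psd_equiv.
Proof.
by move=> p q; apply/idP/idP => /asboolP pq; apply/asboolP; exact: ae_eq_sym.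
Qed.

Lemma psd_equiv_trans : transitive psd_equiv.
Proof.
by move=> q p s /asboolP pq /asboolP qs; apply/asboolP; exact: ae_eq_trans qs.
Qed.

Canonical psd_equiv_rel :=
  EquivRel psd_equiv psd_equiv_refl psd_equiv_sym psd_equiv_trans.

Definition psd : Type := {eq_quot psd_equiv}.
HB.instance Definition _ := Choice.on psd.
HB.instance Definition _ := EqQuotient.on psd.

Definition psd_fun (p : psd) : R -> R := val (repr p).

Definition psd_of (p : R -> R) (fp : feasible p) : psd :=
  \pi_psd (SigSub (mem_set fp) : set_type feasible).

Lemma feasible_on (hP : 0 < P) (A : set R) :
  measurable A -> feasible (fun f => P * \1_A f).
Proof.
move=> mA; split.
  by apply: measurable_funM => //; exact: measurable_indic.
by move=> f _; rewrite indicE; case: (_ \in _);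
  rewrite ?mulr1 ?mulr0 lexx ltW.
Qed.

Definition psd_on (hP : 0 < P) (A : set R) (mA : measurable A) : psd :=
  psd_of (feasible_on hP mA).

Definition psd_full (hP : 0 < P) : psd := psd_on hP measurableT.

End psd.
Arguments psd {R}.
Arguments psd_full {R} S {P} hP.
Arguments psd_on {R} S {P} hP {A} mA.

Section rate_and_revenue.
Context {R : realType}.

Definition strictly_increasing_ge0 (g : R -> R) :=
  forall x y : R, 0 <= x -> x < y -> g x < g y.

Definition is_rate (r : R -> R) :=
  (forall x, 0 <= x -> 0 <= r x) /\ strictly_increasing_ge0 r.

Definition strictly_concave_ge0 (g : R -> R) :=
  forall x y a : R, 0 <= x -> 0 <= y -> x != y -> 0 < a < 1 ->
    a * g x + (1 - a) * g y < g (a * x + (1 - a) * y).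

(* L is the set of possible traffic intensities. Measurability in the traffic
   intensity is what makes the expected utilities meaningful. *)
Definition is_revenue (L : set R) (g : R -> R -> R) :=
  [/\ forall l, L l ->
        [/\ {within `[0, +oo[, continuous (g ^~ l)},
            strictly_increasing_ge0 (g ^~ l) &
            strictly_concave_ge0 (g ^~ l)],
      forall x l k D : R, 0 <= x -> L l -> L k -> l < k -> 0 < D ->
        g (x + D) l - g x l < g (x + D) k - g x k &
      forall x : R, 0 <= x -> measurable_fun L (g x)].

End rate_and_revenue.

Section traffic.
Context {R : realType} {d : measure_display} {Omega : measurableType d}.
Context (Pr : probability Omega R) (n : nat).

Definition process_sigma (X : nat -> {RV Pr >-> R}) : set (set Omega) :=
  <<s \bigcup_t preimage_set_system [set: Omega] (X t) measurable >>.

Definition independent_processes (X : 'I_n -> nat -> {RV Pr >-> R}) :=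
  forall A : 'I_n -> set Omega,
    (forall i, process_sigma (X i) (A i)) ->
    Pr (\bigcap_i A i) = (\prod_(i < n) Pr (A i))%E.

Definition identically_distributed (X : nat -> {RV Pr >-> R}) :=
  forall s t (B : set R), measurable B ->
    distribution Pr (X s) B = distribution Pr (X t) B.

End traffic.

Section game.
Context {R : realType} {S : set R} {P : R} {n : nat}.
Notation mu := (@lebesgue_measure R).
Notation W := (bandwidth S).

Definition action : Type := {ffun 'I_n -> psd S P}.
HB.instance Definition _ := Choice.on action.

(* Chronological order: the last element is the most recent slot. *)
Definition history := seq action.
Definition strategy := history -> psd S P.

Definition sinr (a : action) (i : 'I_n) (f : R) : R :=
  psd_fun (a i) f / (1 + \sum_(j < n | j != i) psd_fun (a j) f).

Variables (r : R -> R) (revenue : 'I_n -> R -> R -> R).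

Definition utility (i : 'I_n) (a : action) (l : R) : R :=
  revenue i ((r P)^-1 * \int[mu]_(f in S) r (sinr a i f)) l.

Definition sup_utility (i : 'I_n) (l : R) : R :=
  sup [set utility i a l | a in [set: action]].

Definition revenue_full (i : 'I_n) (l : R) : R :=
  revenue i (W / r P * r (P / (P * (n%:R - 1) + 1))) l.

Definition play (s : 'I_n -> strategy) (t : nat) : history :=
  iter t (fun h => rcons h [ffun i => s i h]) [::].

Definition played (s : 'I_n -> strategy) (t : nat) : action :=
  [ffun i => s i (play s t)].

Context {d : measure_display} {Omega : measurableType d}.
Context {Pr : probability Omega R}.
Variables (Lam : 'I_n -> nat -> {RV Pr >-> R}) (delta : R).

(* k is the absolute slot at which the (continuation) game starts: it selects
   the traffic intensities, while s sees only the history since slot k. *)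
Definition total_revenue (k : nat) (s : 'I_n -> strategy) (i : 'I_n)
    (w : Omega) : R :=
  (1 - delta) * limn (series
    (fun t => delta ^+ t * utility i (played s t) (Lam i (k + t)%N w))).

Definition payoff (k : nat) (s : 'I_n -> strategy) (i : 'I_n) : \bar R :=
  ('E_Pr[total_revenue k s i])%E.

Definition deviate (s : 'I_n -> strategy) (i : 'I_n) (si : strategy) :
    'I_n -> strategy :=
  fun j => if j == i then si else s j.

Definition is_nash (k : nat) (s : 'I_n -> strategy) :=
  forall i (si : strategy), (payoff k (deviate s i si) i <= payoff k s i)%E.

Definition restriction (s : 'I_n -> strategy) (h : history) :
    'I_n -> strategy :=
  fun i h' => s i (h ++ h').

Definition subgame_perfect (s : 'I_n -> strategy) :=
  forall h : history, is_nash (size h) (restriction s h).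

End game.
Arguments action {R} S P n.
Arguments history {R} S P n.
Arguments strategy {R} S P n.
Arguments sup_utility {R} S P {n}.
Arguments revenue_full {R} S P {n}.

Section equal_orthogonal_sharing.
Context {R : realType} {S : set R} {P : R} {n : nat}.
Variables (hP : 0 < P) (Sp : 'I_n -> set R).
Variable (mSp : forall i, measurable (Sp i)).

Definition orthogonal_sharing : action S P n := [ffun i => psd_on S hP (mSp i)].

(* k is the number of punishment slots left, the current one included; k = 0
   is the cooperation state. *)
Definition prescribed (k : nat) : action S P n :=
  if k is 0%N then orthogonal_sharing else [ffun=> psd_full S hP].

Variable (T : nat).

Definition punishment_left (h : history S P n) : nat :=
  foldl (fun k a => if a == prescribed k then k.-1 else T) 0%N h.

Definition orthogonal_punishment (i : 'I_n) : strategy S P n :=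
  fun h => prescribed (punishment_left h) i.

End equal_orthogonal_sharing.
Arguments orthogonal_sharing {R} S {P n} hP {Sp} mSp.
Arguments orthogonal_punishment {R} S {P n} hP {Sp} mSp T.

(* Main.v *)
(* Since actions are deterministic and traffic has a time-invariant law, the
   expected payoff is a discounted sum of expected one-slot utilities, each a
   monotone function of the share of the band an operator obtains. The rate
   hypothesis forces r(0) = 0, so that orthogonal sharing yields exactly W/n,
   and it makes this at least the share obtained under punishment; under
   punishment full power is the one-slot best response. The full band W bounds
   every share and is attained, so taking the expectation of the gain hypothesis
   shows that the expected one-slot gain of a deviation is strictly less than
   T(u_o - u_f). As delta tends to 1 the discounted cost of T punishment slots
   tends to this bound, so no one-shot deviation pays, and telescoping excludes
   all deviations. *)
Require Import Defs.
From HB Require Import structures.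
From mathcomp Require Import all_boot all_order all_algebra.
From mathcomp Require Import all_classical all_reals all_analysis.
From mathcomp Require Import measurable_realfun.
From mathcomp Require Import lra ring.
Import Order.TTheory GRing.Theory Num.Theory.
Import numFieldNormedType.Exports.

Set Implicit Arguments.
Unset Strict Implicit.
Unset Printing Implicit Defensive.

Local Open Scope classical_set_scope.
Local Open Scope ring_scope.

(** * Discounted series and the recursions that control them *)

Section discounted_sums.
Context {R : realType} (delta : R).
Hypothesis delta01 : 0 <= delta < 1.

Lemma cvg_discounted_series (g : nat -> R) (M : R) :
  (forall t, 0 <= g t <= M) -> cvgn (series (fun t => delta ^+ t * g t)).
Proof.
case/andP: delta01 => d0 d1 gM.
have M0 : 0 <= M by case/andP: (gM 0%N) => /le_trans; apply.
apply: (@series_le_cvg _ _ (geometric M delta)).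
- by move=> t; rewrite mulr_ge0 ?exprn_ge0//; case/andP: (gM t).
- by move=> t; rewrite mulr_ge0 ?exprn_ge0.
- move=> t /=; rewrite mulrC ler_wpM2r ?exprn_ge0//.
  by case/andP: (gM t).
- by apply: is_cvg_geometric_series; rewrite ger0_norm.
Qed.

Lemma cvg_discounted_sum (g : nat -> R) (M : R) :
  (forall t, 0 <= g t <= M) ->
  (1 - delta) * series (fun t => delta ^+ t * g t) N @[N --> \oo] -->
  (1 - delta) * limn (series (fun t => delta ^+ t * g t)).
Proof.
by move=> gM; apply: cvgM; [exact: cvg_cst|exact: cvg_discounted_series gM].
Qed.

(** Multiplying the recursion at time [N] by [delta ^+ N] makes it telescope: the normalised partial
    sum plus the tail [delta ^+ N * v N] never exceeds [v 0]. The tail is nonnegative and is dropped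
    before passing to the limit. Here [v] plays the part of a value function. *)
Lemma discounted_le (g v : nat -> R) (M : R) :
  (forall t, 0 <= g t <= M) -> (forall t, 0 <= v t) ->
  (forall t, (1 - delta) * g t + delta * v t.+1 <= v t) ->
  (1 - delta) * limn (series (fun t => delta ^+ t * g t)) <= v 0%N.
Proof.
case/andP: (delta01) => d0 d1 gM v0 gv.
have partial N : (1 - delta) * series (fun t => delta ^+ t * g t) N +
    delta ^+ N * v N <= v 0%N.
  elim: N => [|N IHN].
    by rewrite /series /= big_geq// mulr0 add0r mul1r.
  rewrite seriesSr.
  have := ler_wpM2l (exprn_ge0 N d0) (gv N).
  by rewrite exprSr; move: IHN; lra.
have sg := cvg_discounted_sum gM.
rewrite -(cvg_lim _ sg)//; apply: limr_le; first exact: cvgP sg.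
near=> N; apply: le_trans (partial N).
by rewrite /= lerDl mulr_ge0 ?exprn_ge0.
Unshelve. all: by end_near. Qed.

(** The same telescoping with equality; the bound [C] now makes the tail [delta ^+ N * v N] vanish
    in the limit. *)
Lemma discounted_eq (g v : nat -> R) (M C : R) :
  (forall t, 0 <= g t <= M) -> (forall t, 0 <= v t <= C) ->
  (forall t, (1 - delta) * g t + delta * v t.+1 = v t) ->
  (1 - delta) * limn (series (fun t => delta ^+ t * g t)) = v 0%N.
Proof.
case/andP: (delta01) => d0 d1 gM vC gv.
have partial N : (1 - delta) * series (fun t => delta ^+ t * g t) N =
    v 0%N - delta ^+ N * v N.
  elim: N => [|N IHN].
    by rewrite /series /= big_geq// mulr0 mul1r subrr.
  rewrite seriesSr mulrDr IHN exprSr -(gv N).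
  by ring.
have sg := cvg_discounted_sum gM.
rewrite -(cvg_lim _ sg)//; apply: cvg_lim => //.
rewrite (_ : (fun N => _) = fun N => v 0%N - delta ^+ N * v N); last first.
  by apply/funext => N /=; rewrite -partial.
rewrite -[X in _ --> X]subr0; apply: cvgB; first exact: cvg_cst.
have dC : delta ^+ N * C @[N --> \oo] --> 0.
  rewrite -[X in _ --> X](mul0r C); apply: cvgM; last exact: cvg_cst.
  by apply: cvg_expr; rewrite ger0_norm.
apply: (@squeeze_cvgr _ _ _ _ (cst 0) (fun N => delta ^+ N * C)) => //;
  last exact: cvg_cst.
near=> N; case/andP: (vC N) => v0 vN.
by rewrite mulr_ge0 ?exprn_ge0//= ler_wpM2l ?exprn_ge0.
Unshelve. all: by end_near. Qed.

End discounted_sums.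

(** * Expectations of bounded and of positive random variables *)

Section expectation.
Context {R : realType} {d : measure_display} {T : measurableType d}.
Context (Pr : probability T R).

Lemma expectation_bounded (X : T -> R) (M : R) :
  measurable_fun setT X -> (forall w, 0 <= X w <= M) ->
  exists2 e : R, ('E_Pr[X] = e%:E)%E & 0 <= e <= M.
Proof.
move=> mX XM.
have X0 w : 0 <= X w by case/andP: (XM w).
(* A space of total mass one has a point, and the bounds at that point give [0 <= M]. *)
have [w _] : [set: T] !=set0.
  apply/set0P/negP => /eqP T0; have := probability_setT Pr.
  by rewrite T0 measure0 => /esym/eqP; rewrite (@eqe R) oner_eq0.
have M0 : 0 <= M by apply: le_trans (X0 w) _; case/andP: (XM w).
have e0 := expectation_ge0 Pr X0.
have eM : ('E_Pr[X] <= M%:E)%E.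
  rewrite -(expectation_cst Pr M); apply: expectation_le => //.
  by apply/aeW => x; case/andP: (XM x).
have ef : ('E_Pr[X])%E \is a fin_num.
  by rewrite ge0_fin_numE// (le_lt_trans eM)// ltry.
exists (fine ('E_Pr[X])%E); first by rewrite fineK.
by rewrite -!lee_fin fineK// e0.
Qed.

(** All terms are nonnegative, so expectation and infinite sum commute. The exchange is made in the
    extended reals, to and from which [EFin_series] carries the convergent real series. *)
Lemma expectation_discounted (delta M : R) (X : nat -> T -> R) (e : nat -> R) :
  0 <= delta < 1 -> (forall t, measurable_fun setT (X t)) ->
  (forall t w, 0 <= X t w <= M) -> (forall t, ('E_Pr[X t])%E = (e t)%:E) ->
  ('E_Pr[fun w => ((1 - delta) *
    limn (series (fun t => delta ^+ t * X t w)))%R])%E =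
  ((1 - delta) * limn (series (fun t => delta ^+ t * e t)))%:E.
Proof.
move=> delta01 mX XM Xe; case/andP: (delta01) => d0 d1.
have X0 t w : 0 <= X t w by case/andP: (XM t w).
have eM t : 0 <= e t <= M.
  by have [x] := expectation_bounded (mX t) (XM t); rewrite Xe => -[<-].
have EFin_series (u : nat -> R) : cvgn (series u) ->
    (limn (series u))%:E = (\sum_(0 <= t <oo) (u t)%:E)%E.
  move=> cu; rewrite -EFin_lim//; congr (limn _).
  by apply/funext => N /=; rewrite seriesEnat /= sumEFin.
have md t : measurable_fun setT (fun w => (delta ^+ t * X t w)%:E).
  by apply/measurable_EFinP; exact: measurable_funM.
have dX0 t w : (0 <= (delta ^+ t * X t w)%:E)%E.
  by rewrite lee_fin mulr_ge0 ?exprn_ge0.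
rewrite unlock /=.
under eq_integral => w _.
  rewrite EFinM EFin_series; last first.
    by apply: (@cvg_discounted_series _ _ delta01 _ M) => t; exact: XM.
  over.
rewrite ge0_integralZl//=; first last.
- by rewrite lee_fin subr_ge0 ltW.
- by move=> w _; exact: nneseries_ge0.
- by apply: ge0_emeasurable_sum => //.
rewrite integral_nneseries// EFinM EFin_series; last first.
  exact: cvg_discounted_series eM.
congr (_ * _)%E; apply: eq_eseriesr => t _.
under eq_integral do rewrite EFinM.
rewrite ge0_integralZl//=.
- by rewrite EFinM -Xe unlock.
- exact/measurable_EFinP.
- by move=> w _; rewrite lee_fin.
- by rewrite lee_fin exprn_ge0.
Qed.

(** With zero expectation, [X] would vanish almost everywhere; as it vanishes nowhere, the whole
    space would be a null set. *)
Lemma expectation_gt0 (X : T -> R) :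
  measurable_fun setT X -> (forall w, 0 < X w) -> (0 < 'E_Pr[X])%E.
Proof.
move=> mX X0; rewrite lt_neqAle expectation_ge0 ?andbT; last first.
  by move=> w; rewrite ltW.
apply/negP; rewrite eq_sym => /eqP; rewrite unlock => EX0.
have mEX : measurable_fun setT (fun w => (X w)%:E) by exact/measurable_EFinP.
have /(ae_eq_integral_abs Pr measurableT mEX)[N [mN N0 subN]] :
    (\int[Pr]_w `|(X w)%:E| = 0)%E.
  rewrite -EX0; apply: eq_integral => w _.
  by rewrite abse_EFin gtr0_norm.
have NT : N = setT.
  apply/seteqP; split => // w _; apply: subN => /= /(_ Logic.I) [Xw].
  by have := X0 w; rewrite Xw ltxx.
have := probability_setT Pr; rewrite -NT [LHS]N0 => /esym/eqP.
by rewrite (@eqe R) oner_eq0.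
Qed.

(** A strict pointwise inequality stays strict in expectation without any uniform gap:
    [expectation_gt0] applies to [Y + c - X], which is integrable by boundedness. *)
Lemma expectation_ltD (X Y : T -> R) (M c x y : R) :
  measurable_fun setT X -> measurable_fun setT Y ->
  (forall w, 0 <= X w <= M) -> (forall w, 0 <= Y w <= M) ->
  ('E_Pr[X] = x%:E)%E -> ('E_Pr[Y] = y%:E)%E ->
  (forall w, X w < Y w + c) -> x < y + c.
Proof.
move=> mX mY XM YM Ex Ey XYc.
have L1 (Z : T -> R) (N : R) : measurable_fun setT Z ->
    (forall w, `|Z w| <= N) -> Z \in Lfun Pr 1.
  move=> mZ ZN; apply/Lfun1_integrable/measurable_bounded_integrable => //.
    by rewrite -ge0_fin_numE// fin_num_measure.
  exists N; split; first exact: num_real.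
  by move=> K NK w _ /=; exact: le_trans (ZN w) (ltW NK).
have absM (Z : T -> R) : (forall w, 0 <= Z w <= M) -> forall w, `|Z w| <= M.
  by move=> ZM w; case/andP: (ZM w) => Z0 ?; rewrite ger0_norm.
have LX := L1 X M mX (absM _ XM); have LY := L1 Y M mY (absM _ YM).
have Lc : cst c \in Lfun Pr 1 by exact: (L1 _ `|c|).
have LYc : Y \+ cst c \in Lfun Pr 1.
  apply: (L1 _ (M + `|c|)) => [|w /=]; first exact: measurable_funD.
  by rewrite (le_trans (ler_normD _ _))// lerD2r absM.
have : (0 < 'E_Pr[((Y \+ cst c) \- X)%R])%E.
  apply: expectation_gt0 => [|w /=]; last by rewrite subr_gt0.
  by apply: measurable_funB => //; exact: measurable_funD.
by rewrite expectationB// expectationD// expectation_cst Ex Ey lte_fin subr_gt0.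
Qed.

End expectation.

(** Finitely many almost-everywhere properties hold simultaneously; this allows changing the
    representatives of all operators' PSDs at once. *)
Lemma ae_eq_finite_family {R : realType} {d : measure_display}
    {T : measurableType d} {mu : {measure set T -> \bar R}} {D : set T}
    {J : finType} {U V : Type} (F : (J -> U) -> V) (p q : J -> T -> U) :
  (forall j, ae_eq mu D (p j) (q j)) ->
  ae_eq mu D (fun x => F (p^~ x)) (fun x => F (q^~ x)).
Proof.
move=> pq; have : \forall x \ae mu, forall j, D x -> p j x = q j x.
  by apply: filter_forall => j; exact: pq.
by apply: filterS => x pqx Dx; congr F; apply/funext => j; exact: pqx.
Qed.

(** * The share of the band produced by a profile of PSDs *)

Section spectrum_share.
Context {R : realType} {S : set R} {P : R} {n : nat}.
Context (r : R -> R).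
Notation mu := (@lebesgue_measure R).
Notation W := (bandwidth S).
Hypotheses (P0 : 0 < P) (mS : measurable S) (muS : mu S = W%:E).
Hypothesis rate_r : is_rate r.

Let rP0 : 0 < r P.
Proof.
by case: rate_r => r0 ri; apply: le_lt_trans (ri 0 P _ P0) => //; exact: r0.
Qed.

Let ler_rate x y : 0 <= x -> x <= y -> r x <= r y.
Proof.
case: rate_r => _ ri x0; rewrite le_eqVlt => /predU1P[->//|xy].
by rewrite ltW// ri.
Qed.

Let Rintegral_cstW (c : R) : \int[mu]_(f in S) c = c * W.
Proof. by rewrite Rintegral_cst. Qed.

(** This is the first argument of [revenue] in [utility]: an outcome affects operator [i] only
    through this number. *)
Definition share (a : action S P n) (i : 'I_n) : R :=
  (r P)^-1 * \int[mu]_(f in S) r (sinr a i f).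

Lemma feasible_psd_fun (p : psd S P) : feasible S P (psd_fun p).
Proof. exact: set_valP. Qed.

Lemma psd_fun_on (A : set R) (mA : measurable A) :
  ae_eq mu S (psd_fun (psd_on S P0 mA)) (fun f => P * \1_A f).
Proof.
rewrite /psd_fun /psd_on /psd_of; set p := SigSub _.
have /eqmodP/asboolP : (repr (\pi_(psd S P)%qT p) = p %[mod psd S P])%qT.
  by rewrite reprK.
exact.
Qed.

Lemma measurable_fun_sinr (q : R -> R) (p : 'I_n -> R -> R) (i : 'I_n) :
  measurable_fun S q -> (forall j, measurable_fun S (p j)) ->
  (forall j f, S f -> 0 <= p j f) ->
  measurable_fun S (fun f => q f / (1 + \sum_(j < n | j != i) p j f)).
Proof.
move=> mq mp p0.
(* Clipping at [0] makes the reciprocal monotone on the whole line, hence measurable; on [S] the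
   interference is nonnegative, so clipping changes nothing. *)
pose inv1 (x : R) := (1 + Num.max 0 x)^-1.
have minv1 : measurable_fun [set: R] inv1.
  apply: nonincreasing_measurable => // x y xy.
  rewrite /inv1 lef_pV2 ?posrE; last 2 first.
  - by rewrite ltr_pwDl// le_max lexx.
  - by rewrite ltr_pwDl// le_max lexx.
  by rewrite lerD2l ge_max !le_max lexx xy orbT.
rewrite (_ : (fun f => _) =
    (fun f => q f * (1 + \sum_(j < n | j != i) p j f)^-1))//.
apply: (@eq_measurable_fun _ _ _ _ _
    (fun f => q f * (inv1 \o (fun f => \sum_(j < n | j != i) p j f)) f)).
  move=> f /set_mem Sf /=; rewrite /inv1 max_r//.
  by apply: sumr_ge0 => j _; exact: p0.
apply: measurable_funM => //; apply: measurableT_comp => //.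
under eq_fun do rewrite big_mkcond.
by apply: measurable_sum => j; case: (j != i).
Qed.

Lemma sinr_ge0_le (x : R) (y : 'I_n -> R) (i : 'I_n) :
  0 <= x <= P -> (forall j, 0 <= y j) ->
  0 <= x / (1 + \sum_(j < n | j != i) y j) <= P.
Proof.
move=> /andP[x0 xP] y0; have s0 : 0 <= \sum_(j < n | j != i) y j.
  by apply: sumr_ge0 => j _; exact: y0.
have s1 : 0 < 1 + \sum_(j < n | j != i) y j by rewrite ltr_pwDl.
rewrite divr_ge0 ?(ltW s1)//= ler_pdivrMr//.
by rewrite (le_trans xP)// ler_peMr ?lerDl// ltW.
Qed.

(** Measurability of [r] comes from monotonicity alone. As [r] is monotone only on nonnegative
    reals, its argument is clipped at [0]. *)
Lemma measurable_fun_rate (s : R -> R) :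
  measurable_fun S s -> (forall f, S f -> 0 <= s f) ->
  measurable_fun S (fun f => r (s f)).
Proof.
move=> ms s0.
apply: (@eq_measurable_fun _ _ _ _ _ ((fun x => r (Num.max 0 x)) \o s)).
  by move=> f /set_mem Sf /=; rewrite max_r// s0.
apply: measurableT_comp => //; apply: nondecreasing_measurable => // x y xy.
apply: ler_rate; first by rewrite le_max lexx.
by rewrite ge_max !le_max lexx xy orbT.
Qed.

Lemma integrable_rate (s : R -> R) :
  measurable_fun S s -> (forall f, S f -> 0 <= s f <= P) ->
  mu.-integrable S (EFin \o (fun f => r (s f))).
Proof.
move=> ms sP; have s0 f : S f -> 0 <= s f by move=> /sP/andP[].
apply: measurable_bounded_integrable => //.
- by rewrite [X in (X < _)%E]muS ltry.
- exact: measurable_fun_rate.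
exists (r P); split; first exact: num_real.
move=> M PM f Sf /=; case/andP: (sP f Sf) => sf0 sfP.
rewrite ger0_norm; last by case: rate_r => r0 _; exact: r0.
by apply: ltW; apply: le_lt_trans PM; exact: ler_rate.
Qed.

(** The representatives picked by [psd_fun] are known only almost everywhere; since the integral
    ignores null sets, explicit functions may replace them. *)
Lemma share_ae (q : 'I_n -> R -> R) (a : action S P n) (i : 'I_n) :
  (forall j, measurable_fun S (q j)) ->
  (forall j f, S f -> 0 <= q j f <= P) ->
  (forall j, ae_eq mu S (psd_fun (a j)) (q j)) ->
  share a i = (r P)^-1 * \int[mu]_(f in S)
    r (q i f / (1 + \sum_(j < n | j != i) q j f)).
Proof.
move=> mq q0P aq; rewrite /share; congr (_ * _); rewrite /Rintegral.
have mrs (p : 'I_n -> R -> R) : (forall j, measurable_fun S (p j)) ->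
    (forall j f, S f -> 0 <= p j f <= P) ->
    measurable_fun S (fun f =>
      (r (p i f / (1 + \sum_(j < n | j != i) p j f)))%:E).
  move=> mp p0P; apply/measurable_EFinP; apply: measurable_fun_rate.
    by apply: measurable_fun_sinr => // j f /(p0P j)/andP[].
  move=> f Sf; have p0 j : 0 <= p j f by case/andP: (p0P j f Sf).
  by have /andP[] := sinr_ge0_le i (p0P i f Sf) p0.
congr fine; apply: ae_eq_integral => //.
- by apply: mrs => [j|j f Sf]; have [mp pP] := feasible_psd_fun (a j);
    [exact: mp|exact: pP].
- exact: mrs.
exact: (ae_eq_finite_family (fun y : 'I_n -> R =>
  (r (y i / (1 + \sum_(j < n | j != i) y j)))%:E) aq).
Qed.

Lemma share_ge0_le (a : action S P n) (i : 'I_n) : 0 <= share a i <= W.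
Proof.
have aP j : feasible S P (psd_fun (a j)) := feasible_psd_fun (a j).
have s0P f : S f -> 0 <= sinr a i f <= P.
  move=> Sf; apply: sinr_ge0_le => [|j]; first exact: (aP i).2.
  by case/andP: ((aP j).2 f Sf).
have ms : measurable_fun S (sinr a i).
  apply: measurable_fun_sinr => [|j|j f Sf]; [exact: (aP i).1|exact: (aP j).1|].
  by case/andP: ((aP j).2 f Sf).
apply/andP; split.
  rewrite mulr_ge0 ?invr_ge0 ?(ltW rP0)//; apply: Rintegral_ge0 => f Sf.
  by case: rate_r => r0 _; apply: r0; case/andP: (s0P f Sf).
rewrite /share ler_pdivrMl//.
rewrite -Rintegral_cstW.
apply: le_Rintegral => //.
- exact: integrable_rate.
- by apply: (@integrable_rate (cst P)) => // f _; rewrite lexx ltW.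
by move=> f Sf; case/andP: (s0P f Sf) => s0 sP; exact: ler_rate.
Qed.

(** On [A i] nobody else transmits, so the SINR is [P]; elsewhere operator [i] is silent and
    [r 0 = 0] removes the contribution. *)
Lemma share_on (A : 'I_n -> set R) (mA : forall j, measurable (A j))
    (i : 'I_n) :
  r 0 = 0 -> A i `<=` S -> (forall j, j != i -> A i `&` A j = set0) ->
  share [ffun j => psd_on S P0 (mA j)] i = fine (mu (A i)).
Proof.
move=> r00 AS AA.
have fA j : feasible S P (fun f => P * \1_(A j) f) by exact: feasible_on.
rewrite (@share_ae (fun j f => P * \1_(A j) f)); last 3 first.
- by move=> j; exact: (fA j).1.
- by move=> j f Sf; exact: (fA j).2.
- by move=> j; rewrite ffunE; exact: psd_fun_on.
have -> : \int[mu]_(f in S) r (P * \1_(A i) f /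
      (1 + \sum_(j < n | j != i) P * \1_(A j) f)) =
    \int[mu]_(f in S) (r P * \1_(A i) f).
  apply: eq_Rintegral => f _; have [Aif|nAif] := pselect (A i f).
    rewrite big1 ?addr0 ?divr1; last first.
      move=> j ji; rewrite indicE memNset ?mulr0// => Ajf.
      by have : (A i `&` A j) f by []; rewrite AA.
    by rewrite indicE mem_set//= !mulr1.
  by rewrite indicE memNset//= !mulr0 mul0r.
rewrite RintegralZl//; last first.
  apply: measurable_bounded_integrable => //.
  - by rewrite [X in (X < _)%E]muS ltry.
  - by apply: measurable_indic; exact: mA.
  exists 1; split; first exact: num_real.
  move=> M M1 f _ /=; rewrite indicE (le_trans _ (ltW M1))//.
  by case: (_ \in _); rewrite ?normr1 ?normr0.
rewrite mulrA mulVf ?gt_eqF// mul1r /Rintegral.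
congr fine; have := integral_indic mu mS (mA i).
by rewrite [_ `&` _]setIidl.
Qed.

Let psd_full_ae : ae_eq mu S (psd_fun (psd_full S P0)) (cst P).
Proof.
rewrite (_ : cst P = fun f => P * \1_[set: R] f); first exact: psd_fun_on.
by apply/funext => f; rewrite indicT mulr1.
Qed.

Let sum_other (i : 'I_n) : \sum_(j < n | j != i) P = P * (n%:R - 1).
Proof.
have sumP : \sum_(j < n) P = P * n%:R.
  by rewrite sumr_const card_ord mulr_natr.
move: sumP; rewrite mulrBr mulr1 (bigD1 i)//= => <-.
by rewrite addrAC subrr add0r.
Qed.

Lemma share_full (a : action S P n) (i : 'I_n) :
  (forall j, a j = psd_full S P0) ->
  share a i = W / r P * r (P / (P * (n%:R - 1) + 1)).
Proof.
move=> aP; rewrite (@share_ae (fun=> cst P)); last 3 first.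
- by move=> j.
- by move=> j f _; rewrite lexx ltW.
- by move=> j; rewrite aP; exact: psd_full_ae.
rewrite /= Rintegral_cstW sum_other [1 + _]addrC.
by rewrite mulrC [RHS]mulrAC [W * _]mulrC.
Qed.

(** Against full-power opponents the interference is the constant [P * (n - 1)], so the SINR grows
    with own power at each frequency and full power is a best response. *)
Lemma share_le_full (a : action S P n) (i : 'I_n) :
  (forall j, j != i -> a j = psd_full S P0) ->
  share a i <= W / r P * r (P / (P * (n%:R - 1) + 1)).
Proof.
move=> aP; have [mp pP] := feasible_psd_fun (a i).
rewrite (@share_ae (fun j => if j == i then psd_fun (a i) else cst P));
  last 3 first.
- by move=> j; case: eqP.
- by move=> j f Sf; case: eqP => _; [exact: pP|rewrite lexx ltW].
- move=> j; case: eqVneq => [->|/aP ->]; first exact: ae_eq_refl.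
  exact: psd_full_ae.
have sumP f : \sum_(j < n | j != i)
    (if j == i then psd_fun (a i) else cst P) f = P * (n%:R - 1).
  by rewrite -(sum_other i); apply: eq_bigr => j /negPf ->.
under eq_Rintegral do rewrite eqxx sumP.
rewrite [leRHS]mulrAC [leRHS]mulrC ler_wpM2l ?invr_ge0 ?(ltW rP0)//.
rewrite [leRHS]mulrC -Rintegral_cstW.
have s0P x : 0 <= x <= P -> 0 <= x / (1 + P * (n%:R - 1)) <= P.
  by move=> x0P; rewrite -(sum_other i); apply: sinr_ge0_le => // _; exact: ltW.
apply: le_Rintegral => //.
- apply: integrable_rate => [|f Sf]; last exact/s0P/pP.
  exact: measurable_funM.
- apply: (@integrable_rate (cst (P / (P * (n%:R - 1) + 1)))) => // f _.
  by rewrite addrC s0P// lexx ltW.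
move=> f Sf; have /andP[p0 pleP] := pP f Sf.
apply: ler_rate; first by case/andP: (s0P _ (pP f Sf)).
rewrite [X in _ <= _ / X]addrC ler_wpM2r// invr_ge0 -(sum_other i).
by rewrite addr_ge0// sumr_ge0// => _ _; exact: ltW.
Qed.

End spectrum_share.

(** If [r 0] were positive, the left side of the hypothesis would be at least [m * r 0], which
    outgrows [r P]. *)
Lemma rate_at0 {R : realType} (r : R -> R) (P : R) :
  is_rate r -> 0 < P ->
  (forall m, (2 <= m)%N -> m%:R * r (P / ((m%:R - 1) * P + 1)) < r P) ->
  r 0 = 0.
Proof.
move=> [r0 ri] P0 rm; apply/eqP; rewrite eq_le r0// andbT leNgt.
apply/negP => r00; have rP0 : 0 <= r P / r 0.
  by rewrite divr_ge0 ?r0// ltW.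
have := archi_boundP rP0; set N := Num.bound _ => rPN.
have := rm N.+2 isT; apply/negP; rewrite -leNgt.
have x0 : 0 < P / ((N.+2%:R - 1) * P + 1).
  by rewrite divr_gt0// ltr_wpDl// mulr_ge0 ?(ltW P0)// subr_ge0 ler1n.
apply: (@le_trans _ _ (N.+2%:R * r 0)); last first.
  by rewrite ler_pM2l// ltW// ri.
rewrite -ler_pdivrMr// (le_trans (ltW rPN))// ler_nat.
exact: leq_trans (leqnSn _) (leqnSn _).
Qed.

(** Divided by [1 - delta], the right side is [delta + ... + delta ^+ T] times [uo - uf], which
    tends to [T * (uo - uf)] as [delta] tends to 1. *)
Lemma punishment_threshold {R : realFieldType} (B uo uf : R) (T : nat) :
  (0 < T)%N -> uo <= B -> B - uo < T%:R * (uo - uf) ->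
  exists2 delta0 : R, 0 <= delta0 < 1 & forall delta, delta0 < delta < 1 ->
    (1 - delta) * (B - uo) <= delta * (1 - delta ^+ T) * (uo - uf).
Proof.
move=> T0 uoB; set G := B - uo; set D := uo - uf => GTD.
have G0 : 0 <= G by rewrite subr_ge0.
have T1 : 1 <= T%:R :> R by rewrite ler1n.
have TD0 : 0 < T%:R * D by exact: le_lt_trans GTD.
have TTD0 : 0 < T%:R * (T%:R * D) by rewrite mulr_gt0// (lt_le_trans _ T1).
have D0 : 0 < D by move: TD0; rewrite pmulr_rgt0// (lt_le_trans _ T1).
(* By [geom] and [bernoulli], the punishment costs at least [1 - delta] times
   [T * D - (1 - delta) * T * (T * D)]. The witness is the [delta] at which the second factor equals
   [G]. *)
exists (1 - (T%:R * D - G) / (T%:R * (T%:R * D))).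
  apply/andP; split.
    rewrite subr_ge0 ler_pdivrMr// mul1r.
    apply: (@le_trans _ _ (T%:R * D)); first by rewrite gerBl.
    by rewrite ler_peMl// ltW.
  by rewrite gtrBl divr_gt0// subr_gt0.
move=> delta /andP[dlo d1].
have d0 : 0 <= delta.
  apply: le_trans (ltW dlo); rewrite subr_ge0 ler_pdivrMr// mul1r.
  apply: (@le_trans _ _ (T%:R * D)); first by rewrite gerBl.
  by rewrite ler_peMl// ltW.
have bernoulli m : 1 - m%:R * (1 - delta) <= delta ^+ m.
  elim: m => [|m IHm]; first by rewrite mul0r subr0.
  rewrite exprS -natr1; have := ler_wpM2l d0 IHm.
  have : 0 <= m%:R * (1 - delta) ^+ 2 by rewrite mulr_ge0 ?sqr_ge0.
  by rewrite expr2; lra.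
(* Each of the [m] terms of [delta + ... + delta ^+ m] is at least [delta ^+ m]. *)
have geom m : (1 - delta) * m%:R * delta ^+ m <= delta * (1 - delta ^+ m).
  elim: m => [|m IHm]; first by rewrite expr0 subrr !mulr0 mul0r.
  have dm1 : delta ^+ m <= 1 by rewrite exprn_ile1// ltW.
  have : 0 <= delta * (1 - delta) * (1 - delta ^+ m).
    by rewrite !mulr_ge0// subr_ge0// ltW.
  rewrite exprS -natr1; have := ler_wpM2l d0 IHm.
  by lra.
apply: le_trans (ler_wpM2r (ltW D0) (geom T)).
rewrite -!mulrA ler_wpM2l ?subr_ge0 ?(ltW d1)//.
have := ler_wpM2r (ltW TD0) (bernoulli T).
have : (1 - delta) * (T%:R * (T%:R * D)) < T%:R * D - G.
  by rewrite -ltr_pdivlMr// ltrBlDr -ltrBlDl.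
by lra.
Qed.

(** Both sides are integrals against the law of [X]. Since [g] is measurable only on [L], it is
    first extended by [0], which no value of [X] detects. *)
Lemma expectation_identical_law {R : realType} {d : measure_display}
    {T : measurableType d} (Pr : probability T R) (X : nat -> {RV Pr >-> R})
    (L : set R) (g : R -> R) (t : nat) :
  identically_distributed X -> measurable L -> measurable_fun L g ->
  (forall l, L l -> 0 <= g l) -> (forall s w, L (X s w)) ->
  ('E_Pr[fun w => g (X t w)] = 'E_Pr[fun w => g (X 0%N w)])%E.
Proof.
move=> lawX mL mg g0 LX.
have gL s : ('E_Pr[fun w => g (X s w)] =
    \int[distribution Pr (X s)]_y ((g \_ L) y)%:E)%E.
  rewrite ge0_integral_distribution; last 2 first.
  - by apply/measurable_EFinP; apply/(measurable_restrictT _ mL).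
  - by move=> y; rewrite lee_fin patchE; case: ifP => // /set_mem /g0.
  rewrite unlock; apply: eq_integral => w _ /=.
  by rewrite patchE mem_set.
rewrite !gL; apply: eq_measure_integral => A mA _; exact: lawX.
Qed.

(* The payoff of conforming forever when [k] punishment slots are left; [uo] and
   [uf] are the one-slot payoffs of cooperation and of punishment. *)
Definition conform_value {R : realType} (delta uo uf : R) (k : nat) : R :=
  (1 - delta ^+ k) * uf + delta ^+ k * uo.

(** * Punishment dynamics along a play, and the comparison of values *)

Section repeated_play.
Context {R : realType} {S : set R} {P : R} {n : nat}.
Variables (hP : 0 < P) (Sp : 'I_n -> set R).
Variables (mSp : forall i, measurable (Sp i)) (T : nat).

Local Notation state := (punishment_left hP mSp T).
Local Notation continuation :=
  (restriction (orthogonal_punishment S hP mSp T)).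

Lemma punishment_left_rcons (h : history S P n) (a : action S P n) :
  state (rcons h a) =
  if a == prescribed hP mSp (state h) then (state h).-1 else T.
Proof. by rewrite /punishment_left -cats1 foldl_cat. Qed.

Lemma punishment_left_le (h : history S P n) :
  (state h <= T)%N.
Proof.
elim/last_ind: h => [//|h a IHh]; rewrite punishment_left_rcons.
by case: ifP => // _; exact: leq_trans (leq_pred _) IHh.
Qed.

Lemma punishment_left_play (h : history S P n) (s : 'I_n -> strategy S P n)
    (t : nat) :
  state (h ++ play s t.+1) =
  if played s t == prescribed hP mSp (state (h ++ play s t))
  then (state (h ++ play s t)).-1 else T.
Proof. by rewrite /= -rcons_cat punishment_left_rcons. Qed.

Lemma played_continuation (h : history S P n) (t : nat) :
  played (continuation h) t =
  prescribed hP mSp (state (h ++ play (continuation h) t)).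
Proof. by apply/ffunP => j; rewrite ffunE. Qed.

Lemma played_deviate (h : history S P n) (i : 'I_n) (si : strategy S P n)
    (t : nat) (j : 'I_n) :
  j != i -> played (deviate (continuation h) i si) t j =
  prescribed hP mSp (state (h ++ play (deviate (continuation h) i si) t)) j.
Proof. by move=> /negPf ji; rewrite ffunE /deviate ji. Qed.

Section one_player.
Variables (u : action S P n -> R) (i : 'I_n) (M B delta : R).
Let uo := u (orthogonal_sharing S hP mSp).
Let uf := u [ffun=> psd_full S hP].
Hypotheses (delta01 : 0 <= delta < 1) (uM : forall a, 0 <= u a <= M).
Hypotheses (uB : forall a, u a <= B) (uf_le : uf <= uo).
Hypothesis u_punished : forall a : action S P n,
  (forall j, j != i -> a j = psd_full S hP) -> u a <= uf.
Hypothesis gain_le :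
  (1 - delta) * (B - uo) <= delta * (1 - delta ^+ T) * (uo - uf).

Local Notation value := (conform_value delta uo uf).

Let d0 : 0 <= delta. Proof. by case/andP: delta01. Qed.
Let d1 : delta <= 1. Proof. by case/andP: delta01 => _ /ltW. Qed.

Let value_bounds k : 0 <= value k <= M.
Proof.
have dk0 : 0 <= delta ^+ k by rewrite exprn_ge0.
have dk1 : 0 <= 1 - delta ^+ k by rewrite subr_ge0 exprn_ile1.
have /andP[uo0 uoM] := uM (orthogonal_sharing S hP mSp).
have /andP[uf0 ufM] := uM [ffun=> psd_full S hP].
rewrite addr_ge0 ?mulr_ge0//= /conform_value.
have := ler_wpM2l dk0 uoM; have := ler_wpM2l dk1 ufM; rewrite -/uo -/uf; lra.
Qed.

(** More punishment slots postpone the better payoff [uo]. *)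
Let value_antitone k m : (k <= m)%N -> value m <= value k.
Proof.
move=> km; have dkm : 0 <= delta ^+ k - delta ^+ m.
  by rewrite subr_ge0 ler_wiXn2l.
have uof : 0 <= uo - uf by rewrite subr_ge0.
by have := mulr_ge0 dkm uof; rewrite /conform_value; lra.
Qed.

(** The Bellman equation of conforming. Since [0.-1 = 0], it also covers cooperation, which
    perpetuates itself. *)
Let value_prescribed k :
  (1 - delta) * u (prescribed hP mSp k) + delta * value k.-1 = value k.
Proof.
by case: k => [|k]; rewrite /conform_value /= ?exprS -/uo -/uf; ring.
Qed.

Lemma discounted_conform (h : history S P n) :
  (1 - delta) * limn (series (fun t =>
    delta ^+ t * u (played (continuation h) t))) = value (state h).
Proof.
rewrite -[h in RHS]cats0.
apply: (discounted_eq delta01 (M := M) (C := M)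
  (v := fun t => value (state (h ++ play (continuation h) t)))) => // t.
by rewrite punishment_left_play played_continuation eqxx value_prescribed.
Qed.

(* One-shot deviation principle: in every state, deviating and conforming from
   the next slot on does not pay, and these inequalities telescope. *)
Lemma discounted_deviate (h : history S P n) (si : strategy S P n) :
  (1 - delta) * limn (series (fun t =>
    delta ^+ t * u (played (deviate (continuation h) i si) t))) <=
  value (state h).
Proof.
rewrite -[h in leRHS]cats0; set s := deviate _ _ _.
apply: (discounted_le delta01 (M := M)
  (v := fun t => value (state (h ++ play s t)))) => // t.
  by case/andP: (value_bounds (state (h ++ play s t))).
rewrite punishment_left_play; have kT := punishment_left_le (h ++ play s t).
have := @played_deviate h i si t; rewrite -/s.
move: (played s t) kT.
case: (state _) => [|k] a kT aj.
  (* Cooperation state: a deviation earns at most [B] and leads to state [T], and [gain_le] is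
     exactly the inequality required. *)
  case: eqP => [->|_]; first by rewrite value_prescribed.
  have := ler_wpM2l (_ : 0 <= 1 - delta) (uB a).
  rewrite subr_ge0 => /(_ d1); move: gain_le; rewrite /conform_value; lra.
case: eqP => [->|_]; first by rewrite value_prescribed.
(* Punishment state: a deviation earns at most [uf] and restarts [T] slots, so it is worth at most
   [value T.+1], no more than the current value. *)
apply: le_trans (value_antitone (leq_trans kT (leqnSn T))).
rewrite -[leRHS](value_prescribed T.+1) lerD2r ler_wpM2l ?subr_ge0//.
by apply: u_punished => j /aj ->; rewrite ffunE.
Qed.

End one_player.

End repeated_play.

Theorem lemma5 (R : realType) (S : set R) (P : R) (n T : nat)
    (r : R -> R) (L : set R) (revenue : 'I_n -> R -> R -> R)
    (d : measure_display) (Omega : measurableType d)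
    (Pr : probability Omega R) (Lam : 'I_n -> nat -> {RV Pr >-> R})
    (Sp : 'I_n -> set R)
    (hn : (2 <= n)%N) (hT : (0 < T)%N)
    (hS : is_spectrum S) (hW : 0 < bandwidth S) (hP : 0 < P)
    (hr : is_rate r)
    (mL : measurable L) (hrev : forall i, is_revenue L (revenue i))
    (hbnd : exists M : R, forall i (a : action S P n) l, L l ->
      0 <= utility r revenue i a l <= M)
    (hLam : forall i t w, L (Lam i t w))
    (hind : independent_processes Lam)
    (hlaw : forall i, identically_distributed (Lam i))
    (mSp : forall i, measurable (Sp i))
    (hdisj : trivIset [set: 'I_n] Sp)
    (hcover : \bigcup_i Sp i = S)
    (hlen : forall i,
      lebesgue_measure (Sp i) = (bandwidth S / n%:R)%:E)
    (hsup : (ereal_sup [set (m%:R * r (P / ((m%:R - 1) * P + 1)))%:E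
               | m in [set m : nat | (2 <= m)%N]] < (r P)%:E)%E)
    (hgain : forall i l, L l ->
      ((sup_utility S P r revenue i l - revenue i (bandwidth S / n%:R) l)%:E
       < T%:R%:E *
         ('E_Pr[fun w => utility r revenue i (orthogonal_sharing S hP mSp) (Lam i 0%N w)]
          - 'E_Pr[fun w => revenue_full S P r revenue i (Lam i 0%N w)]))%E) :
  exists delta0 : R, 0 <= delta0 < 1 /\
    forall delta : R, delta0 < delta < 1 ->
      subgame_perfect r revenue Lam delta (orthogonal_punishment S hP mSp T).
Proof.
have [M hM] := hbnd; set W := bandwidth S in hW hlen hgain *.
have mS : measurable S.
  case: hS => s [_ ->]; apply: bigsetU_measurable => J _.
  exact: measurable_itv.
(* [fine] sends infinities to [0], so a positive bandwidth forces finite measure. *)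
have muS : lebesgue_measure S = W%:E.
  by move: hW; rewrite /W /bandwidth; case: (lebesgue_measure S) => //=;
    rewrite ltxx.
have hrP m : (2 <= m)%N -> m%:R * r (P / ((m%:R - 1) * P + 1)) < r P.
  move=> m2; rewrite -lte_fin; apply: le_lt_trans hsup.
  by apply: ereal_sup_ubound; exists m.
have r00 : r 0 = 0 by exact: rate_at0 hrP.

(* Shares under the best, orthogonal and full-power outcomes *)
pose x i (a : action S P n) := share r a i.
have x_ge0 i a : 0 <= x i a by case/andP: (share_ge0_le hP mS muS hr a i).
(* The best outcome for [i]: full power against silent opponents. *)
pose A (i j : 'I_n) : set R := if j == i then S else set0.
have mA i j : measurable (A i j) by rewrite /A; case: eqP.
pose best i : action S P n := [ffun j => psd_on S hP (mA i j)].
have x_best i : x i (best i) = W.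
  rewrite /x /best (share_on hP mS muS hr)// /A ?eqxx//.
  by move=> j /negPf ->; rewrite setI0.
have x_orth i : x i (orthogonal_sharing S hP mSp) = W / n%:R.
  rewrite /x (share_on hP mS muS hr) ?hlen//.
  - by rewrite -hcover; exact: bigcup_sup.
  - move=> j ji; apply: contra_neqP ji => /eqP/set0P; rewrite setIC.
    exact: hdisj.
pose full : action S P n := [ffun=> psd_full S hP].
have x_full i : x i full = W / r P * r (P / (P * (n%:R - 1) + 1)).
  by rewrite /x (share_full mS hr)// => j; rewrite ffunE.
(* This is the rate hypothesis at [m = n]. *)
have x_full_le i : x i full <= W / n%:R.
  have n0 : 0 < n%:R :> R by rewrite ltr0n ltnW.
  have rP0 : 0 < r P by rewrite -r00; case: hr => _; apply.
  rewrite x_full -mulrA ler_wpM2l ?(ltW hW)// ler_pdivrMl// ler_pdivlMr//.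
  by rewrite [leLHS]mulrC [P * (_ - 1)]mulrC; exact/ltW/hrP.

(* Expected one-slot utilities *)
pose U i (a : action S P n) l := utility r revenue i a l.
have U_mono i a b l : L l -> x i a <= x i b -> U i a l <= U i b l.
  move=> Ll; rewrite le_eqVlt => /predU1P[xab|xab].
    by rewrite /U /utility -!/(share _ _ _) -!/(x _ _) xab.
  case: (hrev i) => /(_ l Ll)[_ gi _] _ _.
  exact: ltW (gi _ _ (x_ge0 i a) xab).
have mUL i a : measurable_fun L (U i a).
  by case: (hrev i) => _ _ /(_ _ (x_ge0 i a)).
have mU i a t : measurable_fun setT (fun w => U i a (Lam i t w)).
  by apply: (measurable_comp mL) => // _ [w _ <-]; exact: hLam.
have UM i a t w : 0 <= U i a (Lam i t w) <= M by exact: hM.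
(* Slot 0 represents every slot, because the law of the traffic is the same in all of them. *)
pose u i a := fine ('E_Pr[fun w => U i a (Lam i 0%N w)])%E.
have uE i a t : ('E_Pr[fun w => U i a (Lam i t w)] = (u i a)%:E)%E.
  rewrite (expectation_identical_law (g := U i a) t (hlaw i) mL)//; last first.
    by move=> l Ll; case/andP: (hM i a l Ll).
  by have [e Ee _] := expectation_bounded Pr (mU i a 0%N) (UM i a 0%N);
    rewrite /u Ee.
have uM i a : 0 <= u i a <= M.
  have [e] := expectation_bounded Pr (mU i a 0%N) (UM i a 0%N).
  by rewrite (uE i a 0%N) => -[->].
have u_mono i a b : x i a <= x i b -> u i a <= u i b.
  move=> xab; rewrite -lee_fin -!(uE i _ 0%N).
  apply: expectation_le => //; try by move=> w; case/andP: (UM i a 0%N w).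
    by move=> w; case/andP: (UM i b 0%N w).
  by apply: aeW => w; exact: U_mono.
have u_best i a : u i a <= u i (best i).
  by apply: u_mono; rewrite x_best; case/andP: (share_ge0_le hP mS muS hr a i).
pose orth := orthogonal_sharing S hP mSp.
have gain i : u i (best i) - u i orth < T%:R * (u i orth - u i full).
  rewrite ltrBlDl.
  apply: (expectation_ltD (mU i (best i) 0%N) (mU i orth 0%N)
    (UM i (best i) 0%N) (UM i orth 0%N) (uE i _ _) (uE i _ _)) => w.
  rewrite -ltrBlDl; have Ll := hLam i 0%N w.
  have := hgain i _ Ll.
  have -> : (fun w => revenue_full S P r revenue i (Lam i 0%N w)) =
      (fun w => U i full (Lam i 0%N w)).
    by apply/funext => w'; rewrite /U /utility -/(share _ _ _) -/(x _ _) x_full.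
  rewrite -/(U i orth) !uE -EFinB -EFinM lte_fin; apply: le_lt_trans.
  rewrite lerB//; last by rewrite -(x_orth i).
  (* The supremum dominates the utility of [best i]; the bound [M] ensures that this real supremum
     is a genuine one. *)
  apply: ub_le_sup; last by exists (best i).
  by exists M => _ [a _ <-]; case/andP: (hM i a _ Ll).
have thr i : exists delta0 : R, 0 <= delta0 < 1 /\
    forall delta, delta0 < delta < 1 -> (1 - delta) * (u i (best i) - u i orth)
      <= delta * (1 - delta ^+ T) * (u i orth - u i full).
  by have [e] := punishment_threshold hT (u_best i orth) (gain i); exists e.
have [dl hdl] := choice thr.
(* One threshold for all operators: a maximum of finitely many numbers in [0,1) stays there. *)
exists (\big[Order.max/0]_i dl i); split.
  elim/big_ind: _ => [|y z|i _]; first by rewrite lexx ltr01.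
    by rewrite le_max gt_max => /andP[-> ->] /andP[_ ->].
  by case: (hdl i).
move=> delta /andP[dlo d1] h i si.
have dli : dl i < delta by apply: le_lt_trans dlo; exact: le_bigmax.
have delta01 : 0 <= delta < 1.
  by rewrite d1 andbT ltW// (le_lt_trans _ dli)//; case: (hdl i) => /andP[].
(* The starting slot [size h] enters only through the traffic, so it disappears in expectation and
   every subgame becomes a deterministic discounted sum. *)
have payoffE s : payoff r revenue Lam delta (size h) s i =
    ((1 - delta) * limn (series (fun t => delta ^+ t * u i (played s t))))%:E.
  exact: (expectation_discounted
    (X := fun t w => U i (played s t) (Lam i (size h + t)%N w))
    delta01 (fun t => mU i _ _) (fun t => UM i _ _) (fun t => uE i _ _)).
rewrite !payoffE lee_fin.
have fo : u i full <= u i orth by apply: u_mono; rewrite x_orth.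
rewrite (discounted_conform hP mSp T delta01 (uM i)).
apply: (discounted_deviate delta01 (uM i) (u_best i) fo).
- by move=> a aP; apply: u_mono; rewrite x_full; exact: share_le_full.
- by case: (hdl i) => _; apply; rewrite dli.
Qed.
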